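(* Let $E$ be a Henselian valued field and $D$ a semiramified division algebra of degree $n$ over $E$. Assume $char(\bar E)$ does not divide $n$. Suppose $K$ is a cyclic maximal subfield of $D$. Then $\Gamma_K/\Gamma_E$ and $\Gamma_D/\Gamma_K$ are cyclic; so $\Gamma_D/\Gamma_E$ is generated by two elements. In particular, for any Henselian valued field $E$ and any semiramified division algebra $D$ of degree $n$ over $E$ with $char(\bar E)$ not dividing $n$, if $n$ is a prime power and $rk(\Gamma_D/\Gamma_E)\ge 3$, then $D$ is non-cyclic.
   Context: Division algebras over $E$ are finite-dimensional with center $E$; the degree of $D$ is $\sqrt{[D:E]}$. The valuation of $E$ extends uniquely to $D$; $\bar D,\bar E$ are the residue division ring and residue field, and $\Gamma_D,\Gamma_K,\Gamma_E$ the value groups. $D$ is semiramified over $E$ if $\bar D$ is a field and $[\bar D:\bar E]=(\Gamma_D:\Gamma_E)=deg(D)$. A cyclic maximal subfield of $D$ is a maximal subfield that is a Galois extension of $E$ with cyclic Galois group; $D$ is cyclic if it has one, and non-cyclic otherwise. For a finite abelian group, $rk$ is its minimal number of generators. *)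

(* Defs.v *)
From HB Require Import structures.
From mathcomp Require Import all_boot all_order all_algebra all_field.
From mathcomp Require Import cyclic.

Set Implicit Arguments.
Unset Strict Implicit.
Unset Printing Implicit Defensive.

Import Order.TTheory GRing.Theory Num.Theory.
Local Open Scope ring_scope.
Local Open Scope quotient_scope.

(* porderZmodType alone has no compatibility between order and addition. *)
HB.mixin Record POrderedZmodule_isOrderedGroup G
    of Num.POrderedZmodule G := {
  ogle_total : total (<=%R : rel G);
  ogleD2l : forall x y z : G, y <= z -> x + y <= x + z
}.

#[short(type="orderedGroupType")]
HB.structure Definition OrderedGroup :=
  {G of Num.POrderedZmodule G & POrderedZmodule_isOrderedGroup G}.

(* G U {oo}, with None for oo. *)
Section Extended.
Variable G : orderedGroupType.
Implicit Types a b : option G.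

Definition vadd a b : option G :=
  if a is Some x then (if b is Some y then Some (x + y) else None) else None.

Definition vle a b : bool :=
  if b is Some y then (if a is Some x then x <= y else false) else true.

Definition vlt a b : bool := ~~ vle b a.

End Extended.

(* Krull valuations of arbitrary rank, not required to be onto G. *)
Record valuation (R : nzRingType) (G : orderedGroupType) := Valuation {
  val_fun :> R -> option G;
  valn_eq0 : forall x, val_fun x = None <-> x = 0;
  valnM : forall x y, val_fun (x * y) = vadd (val_fun x) (val_fun y);
  valnD : forall c x y, vle c (val_fun x) -> vle c (val_fun y) ->
            vle c (val_fun (x + y))
}.

Section ValuationRing.
Variables (R : nzRingType) (G : orderedGroupType) (w : valuation R G).
Implicit Types x y : R.

Definition vring_pred : {pred R} := [pred x | vle (Some 0) (w x)].

Lemma ogle_addge0 (a b : G) : 0 <= a -> 0 <= b -> 0 <= a + b.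
Proof.
move=> a0 b0; apply: (le_trans a0).
by rewrite -[leLHS]addr0; apply: ogleD2l.
Qed.

Lemma oglt_addgt0 (a b : G) : 0 <= a -> 0 < b -> 0 < a + b.
Proof.
move=> a0 b0; rewrite lt_neqAle (ogle_addge0 a0 (ltW b0)) andbT.
apply/eqP => ab0; move: b0; rewrite lt_neqAle => /andP[/eqP nb0 b0].
apply: nb0; apply: le_anti; rewrite b0 /=.
have /esym/eqP := ab0; rewrite addr_eq0 => /eqP ab.
move: (ogleD2l _ _ _ a0 : b + 0 <= b + a).
by rewrite addr0 [b + a]addrC -ab0.
Qed.

Lemma ogdouble_eq0 (g : G) : g + g = 0 -> g = 0.
Proof.
move=> gg0; apply: le_anti.
case/orP: (ogle_total 0 g) => g0; rewrite g0 ?andbT /=.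
  by move: (ogleD2l _ _ _ g0 : g + 0 <= g + g); rewrite addr0 gg0.
by move: (ogleD2l _ _ _ g0 : g + g <= g + 0); rewrite addr0 gg0.
Qed.

Lemma valn0 : w 0 = None. Proof. exact/valn_eq0. Qed.

Lemma valn1 : w 1 = Some 0.
Proof.
case E: (w 1) => [g|]; last by move/valn_eq0/eqP: E; rewrite oner_eq0.
have := valnM w 1 1; rewrite mulr1 E /= => -[] /(congr1 (fun z => z - g)).
by rewrite subrr addrK => <-.
Qed.

Lemma valnN x : w (- x) = w x.
Proof.
have wN1 : w (-1) = Some 0.
  case E: (w (-1)) => [g|]; last first.
    by move/valn_eq0/eqP: E; rewrite oppr_eq0 oner_eq0.
  have := valnM w (-1) (-1); rewrite mulrNN mulr1 valn1 E /= => -[] /esym gg.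
  by rewrite (ogdouble_eq0 gg).
by rewrite -mulN1r valnM wN1 /=; case: (w x) => //= a; rewrite add0r.
Qed.

Lemma vring_subring_closed : subring_closed vring_pred.
Proof.
split; rewrite ?inE ?valn1 //= => x y; rewrite !inE => x0 y0.
  by apply: valnD; rewrite ?valnN.
rewrite valnM; case: (w x) (w y) x0 y0 => [a|] [b|] //=.
exact: ogle_addge0.
Qed.

HB.instance Definition _ :=
  GRing.isSubringClosed.Build R vring_pred vring_subring_closed.

Record vring := VRing { vring_val : R; vring_valP : vring_val \in vring_pred }.

HB.instance Definition _ := [isSub for vring_val].
HB.instance Definition _ := [Choice of vring by <:].
HB.instance Definition _ := [SubChoice_isSubNzRing of vring by <:].

Definition vmax : {pred vring} := [pred a | vlt (Some 0) (w (val a))].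

Lemma vmaxE (a : vring) :
  (a \in vmax) = if w (val a) is Some g then 0 < g else true.
Proof.
rewrite inE /vlt; case: (w (val a)) => //= g.
by case: (@comparable_ltP _ _ 0 g) => //; apply: ogle_total.
Qed.

Lemma vmax_zmod_closed : zmod_closed vmax.
Proof.
split=> [|x y]; first by rewrite vmaxE /= valn0.
rewrite !inE /vlt => x0 y0; apply/negP => xy0.
have [wxy|wyx] : vle (w (val x)) (w (val y)) \/ vle (w (val y)) (w (val x)).
- case: (w (val x)) (w (val y)) => [a|] [b|] /=; do ?by [left | right].
  by apply/orP; apply: ogle_total.
- have : vle (w (val x)) (w (val x - val y)).
    apply: valnD; rewrite ?valnN //.
    by case: (w (val x)) => /=.
  move: xy0 x0; rewrite raddfB /=.
  case: (w (val x)) => [a|]; case: (w (_ - _)) => [b|] //= b0 na ab.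
  by case/negP: na; apply: le_trans b0.
have : vle (w (val y)) (w (val x - val y)).
  apply: valnD; rewrite ?valnN //.
  by case: (w (val y)) => /=.
move: xy0 y0; rewrite raddfB /=.
case: (w (val y)) => [a|]; case: (w (_ - _)) => [b|] //= b0 na ab.
by case/negP: na; apply: le_trans b0.
Qed.

HB.instance Definition _ := GRing.isZmodClosed.Build vring vmax vmax_zmod_closed.

Lemma vmaxMl (a b : vring) : b \in vmax -> a * b \in vmax.
Proof.
rewrite !vmaxE rmorphM valnM; have := valP a; rewrite inE.
by case: (w (val a)) (w (val b)) => [g|] [h|] //=; apply: oglt_addgt0.
Qed.

Lemma vmaxMr (a b : vring) : a \in vmax -> a * b \in vmax.
Proof.
rewrite !vmaxE rmorphM valnM; have := valP b; rewrite inE.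
by case: (w (val a)) (w (val b)) => [g|] [h|] //= h0 g0;
   rewrite addrC; apply: oglt_addgt0.
Qed.

Lemma vmax1 : 1 \notin vmax.
Proof. by rewrite vmaxE rmorph1 valn1 ltxx. Qed.

(* ring_quotient equips quotients with a product only over commutative rings, *)
(* so the product on the quotient by the two-sided ideal vmax is built here.  *)
Definition residue : Type := Quotient.quot vmax.

HB.instance Definition _ := GRing.Zmodule.on residue.
HB.instance Definition _ := EqQuotient.on residue.

Definition residue_one : residue := lift_cst residue 1.
Definition residue_mul := lift_op2 residue *%R.

Lemma pi_residue_mul : {morph \pi_residue : x y / x * y >-> residue_mul x y}.
Proof.
move=> x y; unlock residue_mul; apply/eqP; rewrite piE Quotient.equivE.
rewrite -[_ * _](addrNK (x * repr (\pi_residue y))) -mulrBr.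
rewrite -addrA -mulrBl rpredD //.
  by rewrite vmaxMl // Quotient.idealrBE reprK.
by rewrite vmaxMr // Quotient.idealrBE reprK.
Qed.
Canonical pi_residue_one_morph := PiConst residue_one.
Canonical pi_residue_mul_morph := PiMorph2 pi_residue_mul.

Lemma residue_mulA : associative residue_mul.
Proof. by move=> x y z; rewrite -[x]reprK -[y]reprK -[z]reprK !piE mulrA. Qed.
Lemma residue_mul1l : left_id residue_one residue_mul.
Proof. by move=> x; rewrite -[x]reprK !piE mul1r. Qed.
Lemma residue_mul1r : right_id residue_one residue_mul.
Proof. by move=> x; rewrite -[x]reprK !piE mulr1. Qed.
Lemma residue_mulDl : left_distributive residue_mul +%R.
Proof.
move=> x y z; rewrite -[x]reprK -[y]reprK -[z]reprK.
by rewrite !piE mulrDl.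
Qed.
Lemma residue_mulDr : right_distributive residue_mul +%R.
Proof.
move=> x y z; rewrite -[x]reprK -[y]reprK -[z]reprK.
by rewrite !piE mulrDr.
Qed.
Lemma residue_one_neq0 : residue_one != 0.
Proof. by rewrite piE Quotient.equivE subr0 (negbTE vmax1). Qed.

HB.instance Definition _ := GRing.Zmodule_isNzRing.Build residue
  residue_mulA residue_mul1l residue_mul1r residue_mulDl residue_mulDr
  residue_one_neq0.

Definition res (a : vring) : residue := \pi_residue a.

Definition value_group (S : {pred R}) (g : G) : Prop :=
  exists2 x, x \in S & w x = Some g.

End ValuationRing.

Section QuotientGroups.
(* Quotients A / B of (not necessarily finite) subgroups B <= A of G, through *)
(* representatives.                                                           *)
Variables (G : orderedGroupType) (A B : G -> Prop).

Definition quot_index (m : nat) : Prop :=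
  exists g : 'I_m -> G,
    (forall i, A (g i)) /\ (forall a, A a -> exists! i, B (a - g i)).

Definition quot_generated (k : nat) : Prop :=
  exists g : 'I_k -> G,
    (forall i, A (g i)) /\
    (forall a, A a -> exists z : 'I_k -> int, B (a - \sum_i g i *~ z i)).

Definition quot_cyclic : Prop := quot_generated 1.

Definition quot_rank (r : nat) : Prop :=
  quot_generated r /\ (forall k, quot_generated k -> (r <= k)%N).

End QuotientGroups.

Definition henselian (E : fieldType) (G : orderedGroupType)
    (v : valuation E G) : Prop :=
  forall (f : {poly vring v}) (a : vring v), f \is monic ->
    res f.[a] = 0 -> res f^`().[a] != 0 ->
  exists2 b : vring v, root f b & res b = res a.

(* [B : A] = m for B seen as a left A-module through f. *)
Definition has_left_dim (A B : nzRingType) (f : A -> B) (m : nat) : Prop :=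
  exists b : 'I_m -> B,
    forall x : B, exists! c : 'rV[A]_m, x = \sum_i f (c 0 i) * b i.

Definition ring_is_field (A : nzRingType) : Prop :=
  commutative (@GRing.mul A) /\ (forall x : A, x != 0 -> exists y, x * y = 1).

Section DivisionAlgebras.
Variables (E : fieldType) (D : falgType E).

Definition division_algebra : Prop :=
  (forall x : D, x != 0 -> x \is a GRing.unit) /\ 'Z({:D})%VS = 1%VS.

Definition degree (n : nat) : Prop := \dim {:D} = (n ^ 2)%N.

Definition is_subfield (K : {aspace D}) : Prop :=
  [/\ 1 \in K, {in K &, forall x y, x * y = y * x}
    & {in K, forall x, x^-1 \in K}].

Definition maximal_subfield (K : {aspace D}) : Prop :=
  is_subfield K /\
  (forall L : {aspace D}, is_subfield L -> (K <= L)%VS -> L = K :> {vspace D}).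

(* The Galois theory of the library is about extension types, not subalgebras *)
(* of D; hence K is presented as the image of such an extension (f is         *)
(* injective since L is a field).                                             *)
Definition cyclic_galois (K : {aspace D}) : Prop :=
  exists (L : splittingFieldType E) (f : 'AHom(L, D)),
    [/\ limg f = K :> {vspace D}, galois 1%AS {:L}%AS
      & cyclic 'Gal({:L}%AS / 1%AS)].

Definition cyclic_maximal_subfield (K : {aspace D}) : Prop :=
  maximal_subfield K /\ cyclic_galois K.

Definition cyclic_algebra : Prop :=
  exists K : {aspace D}, cyclic_maximal_subfield K.

End DivisionAlgebras.

Section Semiramified.
Variables (E : fieldType) (D : falgType E) (G : orderedGroupType).
Variables (v : valuation E G) (w : valuation D G).

Definition extends_valuation : Prop := forall c : E, w c%:A = v c.

(* The embedding of residue rings induced by c |-> c%:A; when w extends v the *)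
(* default value of insubd is never used.                                     *)
Definition residue_emb (c : residue v) : residue w :=
  res (insubd (0 : vring w) (val (repr c : vring v))%:A).

Definition semiramified (n : nat) : Prop :=
  [/\ ring_is_field (residue w), has_left_dim residue_emb n
    & quot_index (value_group w predT) (value_group v predT) n].

End Semiramified.

(* Main.v *)
Require Import Defs.
From HB Require Import structures.
From mathcomp Require Import all_boot all_order all_algebra all_field.
From mathcomp Require Import all_fingroup cyclic boolp.
Import Order.TTheory GRing.Theory Num.Theory.
Local Open Scope ring_scope.

(** Write K = f(L), with L / E cyclic Galois of group <[s]>. The valuation w
    of D is given, so everything can be read off from the way L acts on D by
    multiplication on the two sides.

    Right multiplication by f(L) is simultaneously diagonalizable on D viewed
    as a left L-space, with the elements g of the Galois group as eigenvalues:
    D is the sum of the spaces D_g of those x with x f(a) = f(g a) x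
    ([twisted_decomposition]). As the centre of D is E, Galois correspondence
    forces every D_g to be nonzero ([twisted_exists], which is Skolem-Noether
    for K), and maximality of K means D_1 = K, so D_g = K z^i when g = s^i and
    z spans D_s over K. Conjugation by elements of D_g shows that w is
    invariant under the Galois group on K; moreover [K : E] divides n^2, so it
    is invertible in the residue field.

    The engine is a valued version of Dedekind's independence of characters
    ([valued_dedekind]): characters whose residues are pairwise distinct admit
    no cancellation, even up to terms of higher value.

    - Gamma_D / Gamma_K. The characters a |-> a / g(a) of L^* have pairwise
      distinct residues: otherwise some g <> 1 would satisfy
      w(g(a) - a) > w(a) for all nonzero a, and then the trace of g(b) - b along <[g]>, which is 0, would have
      the value of g(b) - b ([gal_tame]). Hence the value of a sum of elements
      of the D_g is the value of one of them ([valn_twisted_sum]), and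
      Gamma_D = Gamma_K + Z w(z).

    - Gamma_K / Gamma_E. Let h generate the inertia group, that is, the group
      of those g that act trivially on the residue field of L. The residue of
      h(x) / x is a character of L^* with values in the roots of unity of that
      field, and it is trivial on units and on E. If it is trivial on x, then
      Dedekind's lemma for representatives of the cosets of inertia, acting on
      the valuation ring, yields a unit a for which the trace of a x has the
      value of x, so that w(x) lies in Gamma_E ([inertia_fixed_value]).
      So Gamma_K / Gamma_E embeds in a finite group of roots of unity of a
      field, which is cyclic.

    Two cyclic layers give two generators, hence rank at most 2. *)

Set Implicit Arguments.
Unset Strict Implicit.
Unset Printing Implicit Defensive.

(** * Twisted elements for a Galois subfield *)

Section GaloisSubfield.
Variables (E : fieldType) (D : falgType E) (L : splittingFieldType E).
Variable f : 'AHom(L, D).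
Local Notation gal := (gal_of {:L}).
Implicit Types (g h : gal) (a b c : L) (x y : D).

(** Automorphisms of L are E-linear, so the whole type [gal_of {:L}] is the
    Galois group and sums over it need no membership condition. *)
Lemma mem_galT g : (g \in 'Gal({:L} / 1))%g.
Proof. by rewrite gal_kAut ?sub1v // kAut1E limg_gal. Qed.

(** The eigenspace of right multiplication by f(L) for the eigenvalue g. *)
Definition twisted g x := forall a, x * f a = f (g a) * x.

Lemma ahomC a b : f a * f b = f b * f a.
Proof. by rewrite -!rmorphM mulrC. Qed.

Lemma twistedM g h x y : twisted g x -> twisted h y -> twisted (h * g)%g (x * y).
Proof.
by move=> xg yh a; rewrite -mulrA yh mulrA xg galM ?memvf // mulrA.
Qed.

Lemma twistedZ g a x : twisted g x -> twisted g (f a * x).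
Proof. by move=> xg b; rewrite -mulrA xg !mulrA ahomC. Qed.

Lemma twisted_generator g a x : <<1; a>>%VS = {:L}%VS ->
  x * f a = f (g a) * x -> twisted g x.
Proof.
move=> La xa b; have /Fadjoin_polyP[p /polyOver1P[q ->] ->]: b \in <<1; a>>%VS.
  by rewrite La memvf.
have xaX i : x * f a ^+ i = f (g a) ^+ i * x.
  elim: i => [|i IHi]; first by rewrite mulr1 mul1r.
  by rewrite exprSr mulrA IHi -mulrA xa mulrA -exprSr.
rewrite horner_coef !rmorph_sum mulr_sumr mulr_suml /=; apply: eq_bigr => i _.
rewrite coef_map /= -scalerAl mul1r !linearZ /= !rmorphXn /= -scalerAl -scalerAr.
by rewrite xaX.
Qed.

Section Decomposition.
Variable a : L.
Hypothesis La : <<1; a>>%VS = {:L}%VS.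

(** This is the action of X - c on D seen as a module over L[X], where L acts
    on the left through f and X acts as right multiplication by f a. *)
Definition factor c x := x * f a - f c * x.

Lemma foldr_factorE (s : seq L) x :
  foldr factor x s =
    \sum_(i < (size s).+1) f (\prod_(c <- s) ('X - c%:P))`_i * x * f a ^+ i.
Proof.
elim: s => [|c s IHs] /=.
  by rewrite big_nil big_ord1 coef1 rmorph1 mul1r mulr1.
rewrite big_cons; set P := \prod_(_ <- s) _ in IHs *.
have Pn : P`_(size s).+1 = 0.
  by rewrite nth_default // size_prod_XsubC.
transitivity (\sum_(i < (size s).+2) f ('X * P)`_i * x * f a ^+ i
              - \sum_(i < (size s).+2) f (c * P`_i) * x * f a ^+ i).
  rewrite /factor IHs; congr (_ - _).
    rewrite [RHS]big_ord_recl coefXM eqxx rmorph0 !mul0r add0r mulr_suml.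
    by apply: eq_bigr => i _; rewrite coefXM /= exprSr !mulrA.
  rewrite [RHS]big_ord_recr /= Pn mulr0 rmorph0 !mul0r addr0 mulr_sumr.
  by apply: eq_bigr => i _; rewrite rmorphM /= !mulrA.
rewrite -sumrB; apply: eq_bigr => i _.
by rewrite mulrBl coefB coefCM rmorphB !mulrBl.
Qed.

(** The product of the X - g(a) has coefficients in E, which is central in D:
    its action on x is right multiplication by its value at a, namely 0. *)
Lemma foldr_factor_eq0 x :
  galois 1%AS {:L}%AS -> foldr factor x [seq g a | g : gal] = 0.
Proof.
move=> galL; rewrite foldr_factorE; set s := image _ _.
set P := \prod_(c <- s) _.
have P1 : P \is a polyOver 1%VS.
  apply/polyOverP => i; rewrite -(elimT galois_fixedField galL).
  apply/fixedFieldP=> [|g _]; first exact: memvf.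
  rewrite -coef_map; congr (_ : {poly _})`_i; rewrite rmorph_prod.
  rewrite /P /s !big_image /= [RHS](reindex_inj (mulIg g)) /=.
  apply: eq_bigr => h _.
  by rewrite rmorphB /= map_polyX map_polyC /= galM ?memvf.
have Pa : P.[a] = 0.
  apply/rootP; rewrite root_prod_XsubC; apply/imageP; exists 1%g => //.
  by rewrite gal_id.
have -> : (size s).+1 = size P by rewrite size_prod_XsubC.
transitivity (x * f P.[a]); last by rewrite Pa rmorph0 mulr0.
rewrite horner_coef rmorph_sum mulr_sumr; apply: eq_bigr => i _ /=.
have /polyOver1P[q Pq] := P1.
have -> : P`_i = (q`_i)%:A by move: (nat_of_ord i) => j; rewrite Pq coef_map.
by rewrite -scalerAl mul1r !linearZ /= rmorph1 rmorphXn -scalerAr -!scalerAl mul1r.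
Qed.

(** An operator killed by a product of distinct linear factors is
    diagonalizable. The factors are removed one at a time: if
    [factor (g a) x] splits over the remaining eigenvalues, dividing each
    component by the difference of eigenvalues gives z with
    [factor (g a) z = factor (g a) x], and x - z is an eigenvector for g. *)
Lemma twisted_decomposition_seq (s : seq gal) x :
  uniq s -> foldr factor x [seq g a | g : gal <- s] = 0 ->
  exists2 y : gal -> D, (forall g, twisted g (y g)) & x = \sum_(g <- s) y g.
Proof.
have aI g h : g a = h a -> g = h.
  move=> gh; apply/eqP/gal_eqP => b _.
  have /Fadjoin_polyP[p /polyOver1P[q ->] ->]: b \in <<1; a>>%VS.
    by rewrite La memvf.
  rewrite -!horner_map /= gh; congr (_.[_]); apply/polyP => i.
  by rewrite !coef_map /= !linearZ /= !rmorph1.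
elim/last_ind: s x => [|s g IHs] x /=.
  by move=> _ ->; exists (fun=> 0) => [g b|]; rewrite ?mul0r ?mulr0 ?big_nil.
rewrite rcons_uniq map_rcons -cats1 foldr_cat /= => /andP[s'g Us] /IHs[//|y ty xy].
(* the division by h a - g a inverts factor (g a) on the h-th summand *)
pose z := \sum_(h <- s) f (h a - g a)^-1 * y h.
have zg : factor (g a) z = factor (g a) x.
  rewrite xy /factor mulr_suml mulr_sumr -sumrB; apply: eq_big_seq => h sh.
  rewrite -mulrA ty !mulrA -mulrBl -!rmorphM -rmorphB /= mulrC -mulrBl.
  rewrite divff ?rmorph1 ?mul1r // subr_eq0; apply: contraNneq s'g => /aI <-.
  by [].
exists (fun h => if h == g then x - z else f (h a - g a)^-1 * y h).
  move=> h; case: eqP => [->|_]; last exact: twistedZ.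
  apply: (twisted_generator La); apply/subr0_eq.
  rewrite mulrBl mulrBr opprD addrACA -opprD -/(factor _ x) -/(factor _ z).
  by rewrite zg subrr.
rewrite -cats1 big_cat big_seq1 /= eqxx -[LHS](subrK z) addrC; congr (_ + _).
by apply: eq_big_seq => h sh; case: eqP s'g => // <-; rewrite sh.
Qed.

End Decomposition.

Lemma twisted_decomposition x : galois 1%AS {:L}%AS ->
  exists2 y : gal -> D, (forall g, twisted g (y g)) & x = \sum_g y g.
Proof.
move=> galL; have [_ sepL _] := and3P galL.
have /esym La := eq_adjoin_separable_generator sepL (sub1v _).
have := foldr_factor_eq0 (separable_generator 1 {:L}) x galL.
rewrite /image_mem => /(twisted_decomposition_seq La (enum_uniq _))[y ty ->].
by exists y; rewrite // big_enum.
Qed.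

End GaloisSubfield.

Section Centraliser.
Variables (E : fieldType) (D : falgType E).

(** An element commuting with K generates with K a commutative subalgebra,
    closed under inverses because D is finite-dimensional. *)
Lemma maximal_subfield_centraliser (K : {aspace D}) x :
  maximal_subfield K -> {in K, forall y, x * y = y * x} -> x \in K.
Proof.
case=> -[K1 Kc KV] Kmax xK; pose F := <<K; x>>%AS.
have KF : (K <= F)%VS := subv_adjoin K x.
suff <- : F = K :> {vspace D} by apply: memv_adjoin.
apply: (Kmax F _ KF); split; [exact: subvP KF _ K1 | | by move=> y; rewrite memvV].
apply/centvsP; set U := (K + <[x]>)%VS.
have UC : (U <= 'C(U))%VS.
  apply/centvsP => _ _ /memv_addP[u Ku [_ /vlineP[b ->] ->]]
    /memv_addP[v Kv [_ /vlineP[c ->] ->]].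
  rewrite !mulrDl !mulrDr (Kc _ _ Ku Kv) -!scalerAl -!scalerAr (xK u Ku) (xK v Kv).
  by rewrite !scalerA [c * b]mulrC addrACA.
have genC (V : {vspace D}) : (U <= 'C(V) -> agenv U <= 'C(V))%VS.
  move=> UV; apply: agenv_sub_modl; last exact: prodv_sub.
  by rewrite -memvE centv1.
by apply: (genC _); rewrite centvC; apply: (genC _).
Qed.

End Centraliser.

Section SkolemNoether.
Variables (E : fieldType) (D : falgType E) (L : splittingFieldType E).
Variable f : 'AHom(L, D).
Local Notation gal := (gal_of {:L}).

Lemma twisted1_limg (K : {aspace D}) x : maximal_subfield K ->
  limg f = K :> {vspace D} -> twisted f 1%g x -> exists a, x = f a.
Proof.
move=> maxK fK x1; have : x \in K.
  apply: maximal_subfield_centraliser => // y; rewrite -fK.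
  by case/memv_imgP => a _ ->; rewrite x1 gal_id.
by rewrite -fK => /memv_imgP[a _ ->]; exists a.
Qed.

Hypotheses (divD : division_algebra D) (galL : galois 1%AS {:L}%AS).

(** The automorphisms that occur in the decomposition of D form a group, and
    an element of L fixed by all of them has a central image in D. So their
    fixed field is E, and they make up the whole Galois group. *)
Lemma twisted_exists (g : gal) : exists2 y, y != 0 & twisted f g y.
Proof.
have [unitD centD] := divD.
pose S := [set h : gal | `[< exists2 y, y != 0 & twisted f h y >]].
have SP h : reflect (exists2 y, y != 0 & twisted f h y) (h \in S).
  by rewrite inE; apply: asboolP.
have gS : group_set S.
  apply/group_setP; split.
    by apply/SP; exists 1 => [|a]; rewrite ?oner_neq0 // gal_id mul1r mulr1.
  move=> h k /SP[y y0 yh] /SP[z z0 zk]; apply/SP; exists (z * y).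
    by apply: contraNneq y0 => zy0; rewrite -(mulKr (unitD _ z0) y) zy0 mulr0.
  exact: twistedM.
suff fixS : fixedField (Group gS) = 1%VS.
  have := gal_fixedField (Group gS); rewrite fixS => galS.
  by apply/SP; rewrite -[S]/(gval (Group gS)) -galS mem_galT.
apply/eqP; rewrite eqEsubv sub1v andbT; apply/subvP => b /mem_fixedFieldP[_ bS].
have : f b \in 'Z({:D})%VS.
  rewrite memv_cap memvf; apply/centvP => x _.
  have [y yt ->] := twisted_decomposition f x galL.
  rewrite mulr_sumr mulr_suml; apply: eq_bigr => h _.
  have [->|y0] := eqVneq (y h) 0; first by rewrite mul0r mulr0.
  by rewrite yt bS //; apply/SP; exists (y h).
rewrite centD => /vlineP[c fb]; apply/vlineP; exists c.
by apply: (fmorph_inj f); rewrite /= fb linearZ /= rmorph1.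
Qed.

Lemma card_gal_dvdn (K : {aspace D}) n : limg f = K :> {vspace D} ->
  degree D n -> (#|'Gal({:L} / 1)%g| %| n ^ 2)%N.
Proof.
move=> fK <-; have -> : #|'Gal({:L} / 1)%g| = \dim K.
  rewrite -fK limg_dim_eq.
    by rewrite -[RHS]divn1 -[X in (_ %/ X)%N](dimv1 L) (galois_dim galL).
  apply/eqP; rewrite eqEsubv sub0v andbT; apply/subvP => a /memv_capP[_].
  by rewrite memv_ker /= fmorph_eq0 memv0.
by apply: skew_field_dimS; [apply: divD.1 | apply: subvf].
Qed.

End SkolemNoether.

(** * Values in an ordered group *)

Section OrderedGroup.
Variable G : orderedGroupType.
Implicit Types (g h : G) (a b c : option G).

Lemma ogcomparable g h : (g >=< h)%O.
Proof. exact: ogle_total. Qed.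

Lemma ogltNge g h : (g < h) = ~~ (h <= g).
Proof. exact: comparable_ltNge (ogcomparable _ _). Qed.

Lemma ogler_add2l g x y : (g + x <= g + y) = (x <= y).
Proof.
apply/idP/idP; last exact: ogleD2l.
by move/(@ogleD2l _ (- g)); rewrite !addKr.
Qed.

Lemma ogltr_add2l g x y : (g + x < g + y) = (x < y).
Proof. by rewrite !ogltNge ogler_add2l. Qed.

Lemma vltE g a : vlt (Some g) a = if a is Some x then g < x else true.
Proof. by case: a => //= x; rewrite /vlt /= ogltNge. Qed.

Lemma vle_refl a : vle a a.
Proof. by case: a => /=. Qed.

Lemma vle_total a b : vle a b || vle b a.
Proof. by case: a b => [x|] [y|] //=; apply: ogle_total. Qed.

Lemma vltW a b : vlt a b -> vle a b.
Proof. by rewrite /vlt; have /orP[->|->] := vle_total a b. Qed.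

Lemma vlt_le_trans b a c : vlt a b -> vle b c -> vlt a c.
Proof.
rewrite /vlt => /[swap] bc; apply: contraNN.
by case: a b c bc => [x|] [y|] [z|] //= yz zx; apply: le_trans zx.
Qed.

Lemma vle_add x y a b : vle (Some x) a -> vle (Some y) b ->
  vle (Some (x + y)) (vadd a b).
Proof.
case: a b => [a|] [b|] //= xa yb; apply: (@le_trans _ _ (x + b)).
  by rewrite ogler_add2l.
by rewrite ![_ + b]addrC ogler_add2l.
Qed.

Lemma vlt_addl x y a b : vle (Some x) a -> vlt (Some y) b ->
  vlt (Some (x + y)) (vadd a b).
Proof.
rewrite !vltE; case: a b => [a|] [b|] //= xa yb; apply: (@lt_le_trans _ _ (x + b)).
  by rewrite ogltr_add2l.
by rewrite ![_ + b]addrC ogler_add2l.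
Qed.

Lemma vadd0 a : vadd a (Some 0) = a.
Proof. by case: a => //= x; rewrite addr0. Qed.

Lemma exists_vle_min (I : eqType) (F : I -> option G) (s : seq I) i0 :
  exists2 i, i \in i0 :: s & {in i0 :: s, forall j, vle (F i) (F j)}.
Proof.
elim: s i0 => [|i1 s IHs] i0.
  by exists i0; rewrite ?inE // => j; rewrite inE => /eqP->; apply: vle_refl.
have [i si imin] := IHs i1; have /orP[le0|le0] := vle_total (F i0) (F i).
  exists i0; first by rewrite inE eqxx.
  move=> j; rewrite inE => /orP[/eqP->|/imin]; first exact: vle_refl.
  by case: (F i0) (F i) (F j) le0 => [a|] [b|] [c|] //=; apply: le_trans.
exists i; first by rewrite inE si orbT.
by move=> j; rewrite inE => /orP[/eqP->|/imin].
Qed.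

End OrderedGroup.

(** * Valuations and independence of characters *)

Section Valuation.
Variables (R : nzRingType) (G : orderedGroupType) (w : valuation R G).
Implicit Types (x y : R) (g : G) (c : option G).

Lemma valnB_lt c x y : vlt c (w x) -> vlt c (w y) -> vlt c (w (x - y)).
Proof.
move=> cx cy; have /orP[xy|yx] := vle_total (w x) (w y).
  by apply: (vlt_le_trans cx); apply: valnD; rewrite ?valnN ?vle_refl.
by apply: (vlt_le_trans cy); apply: valnD; rewrite ?valnN ?vle_refl.
Qed.

Lemma valnD_lt c x y : vlt c (w x) -> vlt c (w y) -> vlt c (w (x + y)).
Proof. by move=> cx cy; rewrite -[y]opprK; apply: valnB_lt; rewrite ?valnN. Qed.

Lemma valnB_ge c x y : vle c (w x) -> vle c (w y) -> vle c (w (x - y)).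
Proof. by move=> cx cy; apply: valnD; rewrite ?valnN. Qed.

Lemma valn0_lt g : vlt (Some g) (w 0).
Proof. by rewrite valn0 vltE. Qed.

Lemma valn_sum_lt g (I : Type) (s : seq I) (P : pred I) (F : I -> R) :
  (forall i, P i -> vlt (Some g) (w (F i))) ->
  vlt (Some g) (w (\sum_(i <- s | P i) F i)).
Proof.
move=> gF; elim/big_ind: _ => //; [exact: valn0_lt | exact: valnD_lt].
Qed.

Lemma valn_sum_ge c (I : Type) (s : seq I) (P : pred I) (F : I -> R) :
  (forall i, P i -> vle c (w (F i))) -> vle c (w (\sum_(i <- s | P i) F i)).
Proof.
move=> gF; elim/big_ind: _ => //; [by rewrite valn0 | exact: valnD].
Qed.

Lemma valn_neq0 x : x != 0 -> exists g, w x = Some g.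
Proof.
by case E: (w x) => [g|]; [exists g | move/valn_eq0: E => ->; rewrite eqxx].
Qed.

Lemma valnX x i g : w x = Some g -> w (x ^+ i) = Some (g *+ i).
Proof.
move=> wx; elim: i => [|i IHi]; first by rewrite valn1.
by rewrite exprS valnM wx IHi mulrS.
Qed.

Lemma valn_natr_ge0 k : vle (Some 0) (w k%:R).
Proof.
elim: k => [|k IHk]; first by rewrite valn0.
by rewrite -natr1; apply: valnD; rewrite ?valn1 //=.
Qed.

Lemma valnM_ge x y g : vle (Some 0) (w x) -> vle (Some g) (w y) ->
  vle (Some g) (w (x * y)).
Proof. by move=> x0 yg; rewrite valnM -[g]add0r (vle_add x0 yg). Qed.

Lemma valnM_ltl x y g : vle (Some 0) (w x) -> vlt (Some g) (w y) ->
  vlt (Some g) (w (x * y)).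
Proof. by move=> x0 yg; rewrite valnM -[g]add0r (vlt_addl x0 yg). Qed.

Lemma valnM_ltr x y g : vle (Some g) (w x) -> vlt (Some 0) (w y) ->
  vlt (Some g) (w (x * y)).
Proof. by move=> xg y0; rewrite valnM -[g]addr0 (vlt_addl xg y0). Qed.

Section Dedekind.
Variables (M : nzRingType) (U : M -> Prop) (I : eqType) (phi : I -> M -> R).
Hypotheses (U1 : U 1) (UM : forall u v, U u -> U v -> U (u * v)).
Hypotheses (phi1 : forall i, phi i 1 = 1)
  (phiM : forall i u v, phi i (u * v) = phi i u * phi i v)
  (phiC : forall i j u v, phi i u * phi j v = phi j v * phi i u)
  (phi_ge0 : forall i u, U u -> vle (Some 0) (w (phi i u))).

(** Dedekind's argument up to higher values. Subtracting [phi j u0] times the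
    relation at u from the relation at [u * u0] removes the index j and
    multiplies each other [x i] by [phi i u0 - phi j u0], a unit for a suitable
    u0; by induction [x i] has value above g. The multiplicative set U lets one
    statement cover characters of a unit group and ring morphisms restricted
    to a valuation ring. *)
Lemma valued_dedekind g (s : seq I) (x : I -> R) : uniq s ->
  {in s &, forall i j, i != j ->
     exists2 u, U u & ~~ vlt (Some 0) (w (phi i u - phi j u))} ->
  {in s, forall i, vle (Some g) (w (x i))} ->
  (forall u, U u -> vlt (Some g) (w (\sum_(i <- s) phi i u * x i))) ->
  {in s, forall i, vlt (Some g) (w (x i))}.
Proof.
elim: s x => [|j s IHs] x //= /andP[s'j Us] sep xg sumx.
have xs : {in s, forall i, vlt (Some g) (w (x i))}.
  move=> i si; have [| | |u0 Uu0 u0ij] := sep i j.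
  - by rewrite inE si orbT.
  - by rewrite inE eqxx.
  - by apply: contraNneq s'j => <-.
  have dge k : vle (Some 0) (w (phi k u0 - phi j u0)).
    by apply: valnB_ge; apply: phi_ge0.
  have := IHs (fun k => (phi k u0 - phi j u0) * x k) Us.
  move=> /(_ _ _ _ i si) dlt.
  have : vlt (Some g) (w ((phi i u0 - phi j u0) * x i)).
    apply: dlt => [k l sk sl|k sk|u Uu].
    - by apply: sep; rewrite inE ?sk ?sl orbT.
    - by apply: valnM_ge (dge k) (xg _ _); rewrite inE sk orbT.
    have -> : \sum_(k <- s) phi k u * ((phi k u0 - phi j u0) * x k) =
        \sum_(k <- j :: s) phi k (u * u0) * x k
        - phi j u0 * \sum_(k <- j :: s) phi k u * x k.
      rewrite !big_cons mulrDr opprD addrACA phiM mulrA phiC subrr add0r.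
      rewrite mulr_sumr -sumrB; apply: eq_bigr => k _.
      by rewrite phiM !mulrA mulrBr mulrBl [phi k u * phi j u0]phiC.
    apply: valnB_lt; first by apply: sumx; apply: UM.
    by apply: valnM_ltl; [apply: phi_ge0 | apply: sumx].
  rewrite valnM !vltE; move: (dge i) u0ij; rewrite vltE.
  case: (w (phi i u0 - _)) => [d|] //= d0; rewrite ogltNge negbK => d0'.
  have -> : d = 0 by apply: le_anti; rewrite d0 d0'.
  by case: (w (x i)) => //= h; rewrite add0r.
move=> i; rewrite inE => /orP[/eqP->|]; last exact: xs.
have := sumx 1 U1; rewrite big_cons phi1 mul1r => gs.
rewrite -(addrK (\sum_(i <- s) phi i 1 * x i) (x j)); apply: valnB_lt => //.
rewrite big_seq; apply: valn_sum_lt => k sk.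
by rewrite phi1 mul1r; apply: xs.
Qed.

End Dedekind.
End Valuation.

(** * Residues *)

Section ResidueMap.
Variables (R : nzRingType) (G : orderedGroupType) (w : valuation R G).
Local Open Scope quotient_scope.

Lemma res1 : res (1 : vring w) = 1.
Proof. by rewrite /res -[RHS]/(residue_one w) piE. Qed.

Lemma resD (a b : vring w) : res (a + b) = res a + res b.
Proof. by rewrite /res [in RHS]piE. Qed.

Lemma resM (a b : vring w) : res (a * b) = res a * res b.
Proof. exact: pi_residue_mul. Qed.

Lemma res_eq (a b : vring w) :
  (res a == res b) = vlt (Some 0) (w (val a - val b)).
Proof. by rewrite /res piE Quotient.equivE inE rmorphB. Qed.

Lemma res0 : res (0 : vring w) = 0.
Proof. by apply: (addIr (res 0)); rewrite -resD !add0r. Qed.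

Lemma res_natr k : res (k%:R : vring w) = k%:R.
Proof.
by elim: k => [|k IHk]; rewrite ?res0 // -!natr1 resD IHk res1.
Qed.

(** A prime of positive value would be the residue characteristic; the general
    case follows by factoring k. *)
Lemma valn_natr_eq0 n k : (forall p, p \in [pchar residue w] -> ~~ (p %| n)%N) ->
  (0 < k)%N -> (forall p, prime p -> (p %| k)%N -> (p %| n)%N) ->
  w k%:R = Some 0.
Proof.
move=> char_n; elim/ltn_ind: k => k IHk k0 kn.
have [k1|k1] := leqP k 1; first by rewrite (@anti_leq k 1) ?k1 // valn1.
have [p0 pk] := (pdiv_prime k1, pdiv_dvd k); set p := pdiv k in p0 pk.
have wp : w p%:R = Some 0.
  have := valn_natr_ge0 w p; case E: (vlt (Some 0) (w p%:R)); last first.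
    move: E; rewrite vltE; case: (w _) => [h|] //= /negbT h0 h0'.
    by move: h0; rewrite ogltNge negbK => h0; rewrite (@le_anti _ _ h 0) ?h0.
  have : p \in [pchar residue w]; last by move=> /char_n; rewrite kn.
  rewrite inE p0 /= -res_natr -res0 res_eq.
  by rewrite rmorph_nat rmorph0 subr0.
rewrite -(divnK pk) natrM valnM wp IHk.
- by rewrite /= addr0.
- by rewrite ltn_Pdiv // prime_gt1.
- by rewrite divn_gt0 ?prime_gt0 // dvdn_leq.
- by move=> q q0 qk; apply: kn => //; apply: dvdn_trans qk (dvdn_div pk).
Qed.
End ResidueMap.

Section ResidueField.
Variables (L : fieldType) (G : orderedGroupType) (u : valuation L G).

(** Extending the residue map by 0 outside the valuation ring spares subtypes
    in the computations with quotients h(x) / x. *)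
Definition resL (a : L) : residue u := res (insubd (0 : vring u) a).

Lemma val_insubd_vring a :
  vle (Some 0) (u a) -> val (insubd (0 : vring u) a) = a.
Proof. by move=> a0; rewrite insubdK. Qed.

Lemma resLM a b : vle (Some 0) (u a) -> vle (Some 0) (u b) ->
  resL (a * b) = resL a * resL b.
Proof.
move=> a0 b0; rewrite /resL -resM; congr res; apply: val_inj.
by rewrite rmorphM /= !val_insubd_vring //; apply: valnM_ge.
Qed.

Lemma resL_eq a b : vle (Some 0) (u a) -> vle (Some 0) (u b) ->
  (resL a == resL b) = vlt (Some 0) (u (a - b)).
Proof. by move=> a0 b0; rewrite res_eq !val_insubd_vring. Qed.

Lemma resL1 : resL 1 = 1.
Proof.
rewrite /resL -res1; congr res; apply: val_inj.
by rewrite val_insubd_vring ?valn1 //= rmorph1.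
Qed.

Lemma valnV a g : u a = Some g -> u a^-1 = Some (- g).
Proof.
move=> ua; have a0 : a != 0.
  by apply/eqP => /(valn_eq0 u a); rewrite ua.
have := valnM u a^-1 a; rewrite mulVf // valn1 ua.
by case: (u a^-1) => //= h [] /eqP; rewrite eq_sym addr_eq0 => /eqP->.
Qed.

(** A copy of [residue u] keeps the field structure, special to valued fields,
    apart from the ring structure common to all residue rings. *)
Definition residue_field : Type := residue u.
HB.instance Definition _ := GRing.NzRing.on residue_field.

Lemma res_repr (x : residue u) : x = res (generic_quotient.repr x : vring u).
Proof. by rewrite /res reprK. Qed.

Lemma residue_field_mulC : commutative (@GRing.mul residue_field).
Proof.
move=> x y; rewrite (res_repr x) (res_repr y).
rewrite -[LHS]resM -[RHS]resM; congr res; apply: val_inj.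
by rewrite !rmorphM /= mulrC.
Qed.
HB.instance Definition _ :=
  GRing.PzSemiRing_hasCommutativeMul.Build residue_field residue_field_mulC.

Definition residue_inv (x : residue_field) : residue_field :=
  if x == 0 then 0 else resL (val (generic_quotient.repr x : vring u))^-1.

Lemma residue_mulVf (x : residue_field) : x != 0 -> residue_inv x * x = 1.
Proof.
move=> x0; rewrite /residue_inv (negPf x0).
have xE : x = resL (val (generic_quotient.repr x : vring u)).
  by rewrite /resL valKd -res_repr.
set a := val _ in xE *.
have a0 : vle (Some 0) (u a) := valP (generic_quotient.repr x).
have ua : u a = Some 0.
  have : ~~ vlt (Some 0) (u (a - 0)).
    rewrite -resL_eq ?valn0 // -xE; apply: contra x0 => /eqP->.
    apply/eqP; rewrite /resL -[RHS](res0 u); congr res; apply: val_inj.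
    by rewrite val_insubd_vring ?valn0 // rmorph0.
  rewrite subr0 vltE; case: (u a) a0 => [h|] //= h0; rewrite ogltNge negbK => h0'.
  by congr Some; apply: le_anti; rewrite h0 h0'.
have /negbTE an0 : a != 0 by apply/eqP => /(valn_eq0 u a); rewrite ua.
by rewrite [x in _ * x]xE -resLM ?(valnV ua) ?oppr0 ?a0 //= mulVf ?an0 // resL1.
Qed.

Lemma residue_inv0 : residue_inv 0 = 0.
Proof. by rewrite /residue_inv eqxx. Qed.
HB.instance Definition _ :=
  GRing.ComNzRing_isField.Build residue_field residue_mulVf residue_inv0.

End ResidueField.

(** A finite subgroup of the multiplicative group of a field is cyclic, for
    subgroups given by a predicate. Finiteness comes from the exponent: a
    duplicate-free list rs of elements of S of maximal size N exhausts S, and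
    multiplication by x in S permutes rs, so that x^N = 1. *)
Lemma unity_roots_monogenic (F : fieldType) (S : F -> Prop) n :
  (0 < n)%N -> S 1 -> (forall x y, S x -> S y -> S (x * y)) ->
  (forall x, S x -> x ^+ n = 1) ->
  exists2 z, S z & forall x, S x -> exists i : nat, x = z ^+ i.
Proof.
move=> n0 S1 SM Sn.
pose P k := `[< exists rs : seq F, [/\ size rs = k, uniq rs
  & forall x, x \in rs -> S x] >].
have P0 : exists k, P k by exists 0%N; apply/asboolP; exists [::].
have Pn k : P k -> (k <= n)%N.
  move=> /asboolP[rs [<- Urs Srs]]; apply: max_unity_roots => //.
  by apply/allP => x /Srs/Sn xn; apply/unity_rootP.
case: (ex_maxnP P0 Pn) => N /asboolP[rs [rsN Urs Srs]] maxN.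
have rsS x : S x -> x \in rs.
  move=> Sx; apply/negPn/negP => rs'x.
  have /maxN : P N.+1; last by rewrite ltnn.
  apply/asboolP; exists (x :: rs); split; rewrite /= ?rsN ?rs'x // => y.
  by rewrite inE => /orP[/eqP->|/Srs].
have S0 x : S x -> x != 0.
  move/Sn=> xn; apply: contra_eq_neq xn => ->.
  by rewrite expr0n -(prednK n0) /= eq_sym oner_eq0.
have SN x : S x -> x ^+ N = 1.
  move=> Sx; have : \prod_(y <- rs) (x * y) = \prod_(y <- rs) y.
    rewrite -(big_map (fun y => x * y) predT id); apply: perm_big.
    have Uxr : uniq [seq x * y | y <- rs].
      by rewrite map_inj_uniq //; apply: mulfI; apply: S0.
    have /uniq_min_size : {subset [seq x * y | y <- rs] <= rs}.
      by move=> _ /mapP[y /Srs Sy ->]; apply/rsS/SM.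
    by rewrite size_map leqnn; case=> // _ /uniq_perm->.
  rewrite big_split /= big_const_seq count_predT iter_mulr_1 rsN => xNP.
  apply: (mulIf (x := \prod_(y <- rs) y)); last by rewrite mul1r.
  by rewrite prodf_seq_neq0; apply/allP => y /Srs/S0.
have N0 : (0 < N)%N by rewrite -rsN; move: (rsS 1 S1); case: (rs).
have : has N.-primitive_root rs.
  apply: has_prim_root; rewrite ?rsN //.
  by apply/allP => x /Srs/SN xN; apply/unity_rootP.
case/hasP => z /Srs Sz zN; exists z => // x /SN /(prim_rootP zN)[i ->].
by exists i.
Qed.

(** * Tame Galois extensions of valued fields *)

Section GaloisValuation.
Variables (E : fieldType) (L : splittingFieldType E) (G : orderedGroupType).
Variable u : valuation L G.
Local Notation gal := (gal_of {:L}).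
Hypothesis galL : galois 1%AS {:L}%AS.
Hypothesis u_gal : forall (g : gal) a, u (g a) = u a.
Hypothesis u_nat : forall k, (k %| #|'Gal({:L} / 1)%g|)%N -> u k%:R = Some 0.
Implicit Types (g h : gal) (a b x : L) (t : G).

Lemma gal_close_expg g a t i : vlt (Some t) (u (g a - a)) ->
  vlt (Some t) (u ((g ^+ i)%g a - a)).
Proof.
move=> ga; elim: i => [|i IHi]; first by rewrite gal_id subrr valn0_lt.
rewrite expgSr galM ?memvf // -(subrK (g a) (g _)) -addrA -rmorphB /=.
by apply: valnD_lt; rewrite ?u_gal.
Qed.

Lemma u_mulrn k a : (k %| #|'Gal({:L} / 1)%g|)%N -> u (a *+ k) = u a.
Proof. by move=> kG; rewrite -mulr_natr valnM u_nat // vadd0. Qed.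

(** Tameness. If g(a) - a has higher value than a = g(b) - b, then the sum of the g^i(a) over the
    cyclic group generated by g is close to [#[g]] a, hence nonzero; but it
    telescopes to 0. *)
Lemma gal_tame g : g != 1%g -> exists2 a, a != 0 & ~~ vlt (u a) (u (g a - a)).
Proof.
move=> g1; have [b gb] : exists b, g b != b.
  apply: contrapT => /forallNP gb; case/eqP: g1; apply/eqP/gal_eqP => b _.
  by rewrite gal_id; apply/eqP/negPn/negP => /gb.
have a0 : g b - b != 0 by rewrite subr_eq0.
exists (g b - b) => //; apply/negP; have [t ua] := valn_neq0 u a0.
set a := g b - b in a0 ua *; rewrite ua => ga.
have : vlt (Some t) (u (\sum_(i < #[g]%g) ((g ^+ i)%g a - a))).
  by apply: valn_sum_lt => i _; apply: gal_close_expg.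
rewrite sumrB sumr_const card_ord.
have -> : \sum_(i < #[g]%g) (g ^+ i)%g a = 0.
  transitivity (\sum_(0 <= i < #[g]%g) ((g ^+ i.+1)%g b - (g ^+ i)%g b)).
    rewrite big_mkord; apply: eq_bigr => i _.
    by rewrite expgS galM ?memvf // rmorphB.
  by rewrite telescope_sumr // expg_order gal_id subrr.
rewrite sub0r valnN u_mulrn ?order_dvdG ?mem_galT // ua.
by rewrite /vlt vle_refl.
Qed.

Definition inertia : {set gal} :=
  [set h : gal | `[< forall a, vle (Some 0) (u a) -> vlt (Some 0) (u (h a - a)) >]].

Lemma inertiaP h : reflect
  (forall a, vle (Some 0) (u a) -> vlt (Some 0) (u (h a - a))) (h \in inertia).
Proof. by rewrite inE; apply: asboolP. Qed.

Lemma inertia_group_set : group_set inertia.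
Proof.
apply/group_setP; split.
  by apply/inertiaP => a _; rewrite gal_id subrr valn0_lt.
move=> g h /inertiaP gI /inertiaP hI; apply/inertiaP => a a0.
rewrite galM ?memvf // -(subrK (h a) (h (g a))) -addrA -rmorphB.
by apply: valnD_lt; [rewrite u_gal; apply: gI | apply: hI].
Qed.
Canonical inertia_group := Group inertia_group_set.

(** Suppose the value t of x is not a value of E. For a in the valuation ring
    the trace of a x lies in E and has value at least t, so above t. On a coset
    of inertia g(a x) is constant up to values above t, so the trace is close
    to [#|inertia|] times the sum of the r(a) r(x) over representatives r of
    the cosets. Distinct representatives have distinct residues, and
    Dedekind's lemma gives r(x) a value above t, against invariance. *)
Lemma inertia_fixed_value x t : u x = Some t ->
  {in inertia, forall h, vlt (Some t) (u (h x - x))} ->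
  exists c : E, u c%:A = Some t.
Proof.
move=> ux xI; apply: contrapT => noc.
pose rep g := repr (inertia :* g)%g; pose R := rep @: [set: gal].
have repE r g : r \in R -> (rep g == r) = (g \in (inertia :* r)%g).
  case/imsetP => k _ ->{r}; apply/eqP/idP => [<-|].
    by rewrite rcoset_repr rcoset_refl.
  rewrite rcoset_repr => /rcoset_eqP gk.
  by rewrite /rep gk.
(* the trace of a x lies in E, whose values avoid t *)
have tr_lt a : vle (Some 0) (u a) -> vlt (Some t) (u (\sum_(g : gal) g (a * x))).
  move=> a0; have /vlineP[c cE] : \sum_(g : gal) g (a * x) \in 1%VS.
    have -> : \sum_(g : gal) g (a * x) = galTrace 1 {:L} (a * x).
      by apply: eq_bigl => g; rewrite mem_galT.
    exact: mem_galTrace galL (memvf _).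
  have : vle (Some t) (u (\sum_(g : gal) g (a * x))).
    apply: valn_sum_ge => g _; rewrite u_gal.
    by apply: valnM_ge; rewrite // ux vle_refl.
  rewrite cE vltE; case uc: (u c%:A) => [s|] //= ts.
  rewrite lt_neqAle ts andbT; apply/eqP => st; apply: noc.
  by exists c; rewrite uc st.
have coset_lt a r : vle (Some 0) (u a) -> r \in R ->
    vlt (Some t)
      (u (\sum_(g : gal | rep g == r) g (a * x) - r (a * x) *+ #|inertia|)).
  move=> a0 rR; rewrite (eq_bigl _ _ (fun g => repE r g rR)).
  rewrite -(card_rcoset _ r) -sumr_const -sumrB; apply: valn_sum_lt => g.
  case/rcosetP => h hI ->; rewrite galM ?memvf // -rmorphB u_gal.
  have -> : h (a * x) - a * x = h a * (h x - x) + (h a - a) * x.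
    by rewrite rmorphM mulrBr mulrBl addrA subrK.
  apply: valnD_lt; first by apply: valnM_ltl; [rewrite u_gal | apply: xI].
  by rewrite mulrC; apply: valnM_ltr; [rewrite ux vle_refl | apply: (inertiaP _ hI)].
have sum_lt a : vle (Some 0) (u a) ->
    vlt (Some t) (u (\sum_(r <- enum R) r a * r x)).
  move=> a0; rewrite big_enum -(@u_mulrn #|inertia|); last first.
    by apply: cardSg; apply/subsetP => g _; apply: mem_galT.
  set S := (X in u X); rewrite -(subKr (\sum_(g : gal) g (a * x)) S).
  apply: valnB_lt; first exact: tr_lt.
  rewrite (partition_big rep (mem R)) /= => [|g _]; last exact: imset_f.
  rewrite /S -sumrMnl -sumrB; apply: valn_sum_lt => r rR.
  by rewrite -rmorphM; apply: coset_lt.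
have := @valued_dedekind L G u L (fun a => vle (Some 0) (u a)) gal
  (fun g a => g a) _ _ _ _ _ _ t (enum R) (fun g => g x) (enum_uniq _).
move=> /(_ _ _ _ _ _ _ _ _ sum_lt (rep 1%g)).
have R1 : rep 1%g \in enum R by rewrite mem_enum imset_f.
rewrite R1 u_gal ux /vlt vle_refl => H; apply: notF; apply: H => //.
- by rewrite valn1 /=.
- by move=> a b; apply: valnM_ge.
- by move=> g; rewrite rmorph1.
- by move=> g a b; rewrite rmorphM.
- by move=> g h a b; rewrite mulrC.
- by move=> g a; rewrite u_gal.
(* r s^-1 is not in inertia: it moves some integral a modulo higher values,   *)
(* and so r and s differ there                                                *)
- move=> r s; rewrite !mem_enum => rR sR rs.
  have : (r * s^-1)%g \notin inertia.
    rewrite -mem_rcoset -repE //; apply: contra rs => /eqP <-.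
    case/imsetP: rR => k _ ->; rewrite /rep.
    by rewrite rcoset_repr.
  move=> /inertiaP /existsNP[a /not_implyP[a0 /negP rsa]]; exists a => //.
  move: rsa; rewrite galM ?memvf // -(u_gal s) rmorphB /=.
  by rewrite -(galM (s^-1)%g) ?memvf // mulVg gal_id.
- by move=> g _; rewrite u_gal ux vle_refl.
Qed.

Hypothesis cycL : cyclic 'Gal({:L} / 1)%g.

(** With h a generator of inertia, chi(x) is the residue of h(x) / x. Since h
    acts trivially on residues, chi(x)^i is the residue of h^i(x) / x, so the
    values of chi are roots of unity; they are the powers of some chi(x0).
    If chi(x) = chi(x0)^i, then [inertia_fixed_value] applies to x / x0^i. *)
Lemma cyclic_value_group : exists2 x0, x0 != 0 & forall x, x != 0 ->
  exists i : nat, exists c : E, u x = u (x0 ^+ i * c%:A).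
Proof.
have /cyclicP[h Ih] : cyclic inertia.
  by apply: cyclicS cycL; apply/subsetP => g _; apply: mem_galT.
have hI : h \in inertia by rewrite Ih cycle_id.
have u0 x : x != 0 -> u (h x / x) = Some 0.
  move=> /(valn_neq0 u)[t ux].
  by rewrite valnM u_gal ux (valnV ux) /= subrr.
have u0' x : x != 0 -> vle (Some 0) (u (h x / x)) by move=> x0; rewrite u0 /=.
pose chi x : residue_field u := resL u (h x / x).
have chiM x y : x != 0 -> y != 0 -> chi (x * y) = chi x * chi y.
  by move=> x0 y0; rewrite /chi rmorphM invfM mulrACA resLM ?u0'.
have chi1 : chi 1 = 1 by rewrite /chi rmorph1 divr1 resL1.
have chiX x i : x != 0 -> chi (x ^+ i) = chi x ^+ i.
  move=> x0; elim: i => [|i IHi]; first exact: chi1.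
  by rewrite !exprS chiM ?expf_neq0 ?IHi.
have chi_order x : x != 0 -> chi x ^+ #[h]%g = 1.
  move=> x0.
  have chi_iter i : vle (Some 0) (u ((h ^+ i)%g x / x)) /\
       resL u ((h ^+ i)%g x / x) = chi x ^+ i.
    elim: i => [|i [IH0 IHi]].
      by rewrite gal_id divff // resL1 valn1 /=.
    have -> : (h ^+ i.+1)%g x / x = h ((h ^+ i)%g x / x) * (h x / x).
      rewrite expgSr galM ?memvf // fmorph_div mulrA divfK ?fmorph_eq0 //.
    have hge : vle (Some 0) (u (h ((h ^+ i)%g x / x))) by rewrite u_gal.
    split; first by apply: valnM_ge; rewrite ?u0'.
    rewrite resLM ?u0' // exprSr -IHi; congr (_ * _).
    by apply/eqP; rewrite resL_eq //; apply: (inertiaP _ hI).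
  by have [_ <-] := chi_iter #[h]%g; rewrite expg_order gal_id divff ?resL1.
have [|||_ [x0 x00 ->] gen] := @unity_roots_monogenic (residue_field u)
    (fun z => exists2 x, x != 0 & z = chi x) #[h]%g (order_gt0 h).
- by exists 1; rewrite ?oner_neq0.
- move=> _ _ [x x0 ->] [y y0 ->]; exists (x * y); first exact: mulf_neq0.
  by rewrite chiM.
- by move=> _ [x x0 ->]; apply: chi_order.
exists x0 => // x xn0; have [i chix] := gen _ (ex_intro2 _ _ x xn0 erefl).
have xi0 : x0 ^+ i != 0 by rewrite expf_neq0.
have yn0 : x / x0 ^+ i != 0 by rewrite mulf_neq0 ?invr_eq0.
set y := x / _ in yn0; have xy : x = x0 ^+ i * y by rewrite mulrC divfK.
have chiy : chi y = 1.
  have chi0 : chi (x0 ^+ i) != 0.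
    apply/eqP => c0; move: (chi_order _ xi0).
    by rewrite c0 expr0n eqn0Ngt order_gt0 => /esym/eqP; rewrite oner_eq0.
  by apply: (mulfI chi0); rewrite mulr1 -chiM // -xy chix chiX.
have [t uy] := valn_neq0 u yn0.
have [|c uc] := inertia_fixed_value uy; last first.
  by exists i, c; rewrite xy (valnM u _ y) [RHS]valnM uc uy.
suff hy : vlt (Some t) (u (h y - y)).
  by move=> g; rewrite Ih => /cycleP[j ->]; apply: gal_close_expg.
have : vlt (Some 0) (u (h y / y - 1)).
  by rewrite -resL_eq ?u0' ?valn1 //= resL1; apply/eqP.
rewrite -[u (h y - y)]/(u (h y - y)).
have -> : h y - y = y * (h y / y - 1) by rewrite mulrBr mulr1 mulrC divfK.
by apply: valnM_ltr; rewrite uy vle_refl.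
Qed.

End GaloisValuation.

(** * Values of sums of twisted elements *)

Section ValuedDivisionAlgebra.
Variables (E : fieldType) (D : falgType E) (L : splittingFieldType E).
Variables (G : orderedGroupType) (w : valuation D G) (f : 'AHom(L, D)).
Local Notation gal := (gal_of {:L}).
Implicit Types (g h : gal) (a b : L) (x y : D).

Section Pullback.
Let wf a := w (f a).

Lemma valn_ahom_eq0 a : wf a = None <-> a = 0.
Proof.
split=> [/valn_eq0 /eqP|->]; last by rewrite /wf rmorph0 valn0.
by rewrite fmorph_eq0 => /eqP.
Qed.

Lemma valn_ahomM a b : wf (a * b) = vadd (wf a) (wf b).
Proof. by rewrite /wf rmorphM valnM. Qed.

Lemma valn_ahomD c a b : vle c (wf a) -> vle c (wf b) -> vle c (wf (a + b)).
Proof. by rewrite /wf rmorphD; apply: valnD. Qed.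

Definition valn_ahom := Valuation valn_ahom_eq0 valn_ahomM valn_ahomD.
End Pullback.

Hypothesis unitD : forall x : D, x != 0 -> x \is a GRing.unit.

(** From y f(a) = f(g a) y, because values commute. *)
Lemma valn_twisted g y a : y != 0 -> twisted f g y -> w (f (g a)) = w (f a).
Proof.
move=> /(valn_neq0 w)[t wy] /(_ a) /(congr1 w); rewrite !valnM wy.
case: (w (f a)) (w (f (g a))) => [s|] [r|] //= [] /eqP.
by rewrite addrC (inj_eq (addIr t)) => /eqP->.
Qed.

Lemma twistedX g y i : twisted f g y -> twisted f (g ^+ i)%g (y ^+ i).
Proof.
move=> yg; elim: i => [|i IHi]; first by move=> a; rewrite gal_id mul1r mulr1.
by rewrite exprS expgSr; apply: twistedM.
Qed.

Lemma twisted_div g y z : z != 0 -> twisted f g y -> twisted f g z ->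
  twisted f 1%g (y / z).
Proof.
move=> /unitD Uz yg zg a; rewrite gal_id; apply: (mulIr Uz).
rewrite -!mulrA mulVr // mulr1.
have := zg (g^-1%g a); rewrite -galM ?memvf // mulVg gal_id => <-.
by rewrite mulrA mulrA divrK // yg -galM ?memvf // mulVg gal_id.
Qed.

Section Orthogonality.
Hypothesis galL : galois 1%AS {:L}%AS.
Hypothesis w_gal : forall g a, w (f (g a)) = w (f a).
Hypothesis w_nat :
  forall k, (k %| #|'Gal({:L} / 1)%g|)%N -> valn_ahom k%:R = Some 0.

(** Conjugating x by f(a) keeps its value and multiplies the component of index
    h by the unit f(a / h(a)). If x had a value above the least value of its
    components, so would all these conjugates, against Dedekind's lemma: the
    characters a / h(a) are separated by [gal_tame]. *)
Lemma valn_twisted_sum (y : gal -> D) : (forall g, twisted f g (y g)) ->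
  exists g, w (\sum_h y h) = w (y g).
Proof.
move=> yt; have [g _ gmin] := exists_vle_min (fun h => w (y h)) (enum {: gal}) 1%g.
have {}gmin h : vle (w (y g)) (w (y h)) by apply: gmin; rewrite inE mem_enum orbT.
exists g; set x := \sum_h y h.
have xge : vle (w (y g)) (w x) by apply: valn_sum_ge.
case wg : (w (y g)) xge gmin => [t|] xge gmin; last by case: (w x) xge.
apply: contrapT => xt.
have xlt : vlt (Some t) (w x).
  rewrite vltE; case wx : (w x) xge xt => [s|] //= ts st.
  by rewrite lt_neqAle ts andbT; apply/eqP => tsE; apply: st; rewrite tsE.
have : vlt (Some t) (w (y g)); last by rewrite wg /vlt vle_refl.
apply: (@valued_dedekind D G w L (fun a => a != 0) gal
  (fun h a => f (a / h a)) _ _ _ _ _ _ t (enum {: gal})).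
- exact: oner_neq0.
- by move=> a b; apply: mulf_neq0.
- by move=> h; rewrite rmorph1 divr1 rmorph1.
- by move=> h a b; rewrite -rmorphM (rmorphM h) invfM mulrACA.
- by move=> h k a b; apply: ahomC.
- move=> h a /(valn_neq0 valn_ahom)[s us].
  rewrite -[w _]/(valn_ahom _) valnM us (@valnV _ _ _ (h a) s) /= ?subrr //.
  by rewrite -us; apply: w_gal.
- exact: enum_uniq.
- move=> h k _ _ hk.
  (* tameness of h k^-1 at a separates the characters h and k at the same a *)
  have [|a a0 tame] := gal_tame (u := valn_ahom) w_gal w_nat (g := (h * k^-1)%g).
    by apply: contra hk => /eqP hk1; rewrite -(mulgKV k h) hk1 mul1g.
  exists a => //; apply: contra tame; have [s us] := valn_neq0 valn_ahom a0.
  have ug (l : gal) : valn_ahom (l a) = Some s by rewrite -us; exact: w_gal.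
  have un0 (l : gal) : l a != 0 by apply/eqP => /(valn_eq0 valn_ahom); rewrite ug.
  rewrite -rmorphB -[w _]/(valn_ahom _) us => lt0.
  rewrite -[valn_ahom (_ - _)]/(w (f _)) -(w_gal k) rmorphB /=.
  rewrite -(galM (h * k^-1)%g k) ?memvf // mulgKV.
  have -> : h a - k a = - (k a * h a / a * (a / h a - a / k a)).
    rewrite mulrBr opprB !mulrA !divfK //.
    by rewrite [k a * h a]mulrC mulfK // [h a * k a]mulrC mulfK.
  rewrite -[w _]/(valn_ahom _) valnN; apply: valnM_ltr => //.
  by rewrite !valnM !ug (valnV us) /= addrK.
- by move=> h _; apply: gmin.
- move=> a a0.
  have -> : \sum_(h <- enum {: gal}) f (a / h a) * y h = f a * x * f a^-1.
    rewrite big_enum /= /x mulr_sumr mulr_suml; apply: eq_bigr => h _.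
    by rewrite rmorphM -!mulrA yt /= (fmorphV h).
  have [s us] := valn_neq0 valn_ahom a0.
  rewrite !valnM -[w (f a^-1)]/(valn_ahom _) (valnV us).
  rewrite -[w (f a)]/(valn_ahom _) us; move: xlt; rewrite !vltE.
  by case: (w x) => //= r; rewrite addrAC subrr add0r.
- by rewrite mem_enum.
Qed.

End Orthogonality.
End ValuedDivisionAlgebra.

(** * Generators of the quotients of value groups *)

Section QuotientGenerators.
Variable G : orderedGroupType.
Implicit Types A B C : G -> Prop.

Lemma quot_cyclic_nat A B g : A g ->
  (forall a, A a -> exists i : nat, B (a - g *+ i)) -> quot_cyclic A B.
Proof.
move=> Ag gen; exists (fun=> g); split=> // a /gen[i Bi].
by exists (fun=> i%:Z); rewrite big_ord1.
Qed.

Lemma quot_generated_trans A B C m n : (forall b, B b -> A b) ->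
  quot_generated A B m -> quot_generated B C n -> quot_generated A C (m + n).
Proof.
move=> BA [g [Ag gen_g]] [h [Bh gen_h]].
exists (fun i => match split i with inl j => g j | inr j => h j end); split.
  by move=> i; case: split => j; [apply: Ag | apply/BA/Bh].
move=> a /gen_g[y /gen_h[z Cz]].
exists (fun i => match split i with inl j => y j | inr j => z j end).
rewrite big_split_ord /= opprD addrA; congr (C (_ - _ - _)): Cz.
  by apply: eq_bigr => i _; rewrite (unsplitK (inl i)).
by apply: eq_bigr => i _; rewrite (unsplitK (inr i)).
Qed.
End QuotientGenerators.

Section CyclicMaximalSubfield.
Variables (G : orderedGroupType) (E : fieldType) (v : valuation E G).
Variables (D : falgType E) (w : valuation D G) (n : nat) (K : {aspace D}).
Hypotheses (divD : division_algebra D) (degD : degree D n).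
Hypothesis ext : extends_valuation v w.
Hypothesis char_n : forall p, p \in [pchar residue v] -> ~~ (p %| n)%N.
Hypothesis cycK : cyclic_maximal_subfield K.

Lemma cyclic_maximal_subfield_value_groups :
  quot_cyclic (value_group w (mem K)) (value_group v predT) /\
  quot_cyclic (value_group w predT) (value_group w (mem K)).
Proof.
have [maxK [L [f [fK galL cycL]]]] := cycK; have [unitD _] := divD.
have KP x : reflect (exists a, x = f a) (x \in K).
  rewrite -fK; apply: (iffP memv_imgP) => [[a _ ->]|[a ->]]; exists a => //.
  exact: memvf.
have w_gal (g : gal_of {:L}) a : w (f (g a)) = w (f a).
  have [y y0 yg] := twisted_exists f divD galL g.
  exact: valn_twisted y0 yg.
pose u := valn_ahom w f.
have u_nat k : (k %| #|'Gal({:L} / 1)%g|)%N -> u k%:R = Some 0.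
  move=> kG; have kn := dvdn_trans kG (card_gal_dvdn divD galL fK degD).
  have -> : u k%:R = v k%:R by rewrite -ext scaler_nat /u /= rmorph_nat.
  have n0 : (0 < n)%N by case: (n) degD (adim_gt0 {:D}) => // ->.
  apply: (valn_natr_eq0 char_n); first by rewrite (dvdn_gt0 _ kn) ?expn_gt0 ?n0.
  by move=> p p_pr pk; move: (dvdn_trans pk kn); rewrite Euclid_dvdX // andbT.
split.
  have [x0 x00 gen] := cyclic_value_group (u := u) galL w_gal u_nat cycL.
  have [t ux0] := valn_neq0 u x00.
  apply: (@quot_cyclic_nat _ _ _ t); first by exists (f x0); [apply/KP; exists x0|].
  move=> s [_ /KP[x ->] ws]; have xn0 : x != 0.
    by apply/eqP => /(valn_eq0 u x); rewrite /= ws.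
  have [i [c uxc]] := gen x xn0; exists i; exists c => //.
  move: uxc; rewrite valnM (valnX i ux0) /= ws linearZ /= rmorph1 ext.
  by case: (v c) => //= r [->]; rewrite addrAC subrr add0r.
have /cyclicP[s sG] := cycL.
have [z z0 zs] := twisted_exists f divD galL s.
have [t wz] := valn_neq0 w z0.
apply: (@quot_cyclic_nat _ _ _ t); first by exists z.
move=> r [x _ wx]; have [y yt xy] := twisted_decomposition f x galL.
have [g xg] := valn_twisted_sum w_gal u_nat yt.
have /cycleP[i gi] : (g \in <[s]>)%g by rewrite -sG mem_galT.
have zi0 : z ^+ i != 0.
  by apply/eqP => /(valn_eq0 w); rewrite (valnX i wz).
have zg : twisted f g (z ^+ i) by rewrite gi; apply: twistedX.
(* y g / z^i commutes with f(L), hence lies in K *)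
have [a ya] := twisted1_limg maxK fK (twisted_div unitD zi0 (yt g) zg).
exists i; exists (f a); first by apply/KP; exists a.
have : w (y g) = Some r by rewrite -xg -xy.
rewrite -(divrK (unitD _ zi0) (y g)) ya valnM (valnX i wz).
by case: (w (f a)) => //= q [<-]; rewrite addrK.
Qed.
End CyclicMaximalSubfield.

Theorem proposition3p1 (G : orderedGroupType) (E : fieldType)
    (v : valuation E G) (D : falgType E) (w : valuation D G) (n : nat) :
  henselian v ->
  division_algebra D -> degree D n ->
  extends_valuation v w -> semiramified v w n ->
  (forall p : nat, p \in [pchar residue v] -> ~~ (p %| n)%N) ->
  (forall K : {aspace D}, cyclic_maximal_subfield K ->
     [/\ quot_cyclic (value_group w (mem K)) (value_group v predT),
         quot_cyclic (value_group w predT) (value_group w (mem K))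
       & quot_generated (value_group w predT) (value_group v predT) 2]) /\
  ((exists p k : nat, [/\ prime p, (0 < k)%N & n = (p ^ k)%N]) ->
   forall r : nat,
     quot_rank (value_group w predT) (value_group v predT) r -> (3 <= r)%N ->
     ~ cyclic_algebra D).
Proof.
move=> _ divD degD ext _ char_n.
have main (K : {aspace D}) : cyclic_maximal_subfield K ->
     [/\ quot_cyclic (value_group w (mem K)) (value_group v predT),
         quot_cyclic (value_group w predT) (value_group w (mem K))
       & quot_generated (value_group w predT) (value_group v predT) 2].
  move=> /(cyclic_maximal_subfield_value_groups divD degD ext char_n)[cycKE cycDK].
  split=> //; apply: quot_generated_trans cycDK cycKE.
  by move=> b [x _ wx]; exists x.
split=> // _ r [_ rmin] r3 [K /main[_ _ /rmin]].
by rewrite leqNgt r3.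
Qed.
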